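(* Consider the grouped dependence model with $n$ hypotheses, $m=n^{1-s}$ signals, shift $\mu=\sqrt{2r\log n}$ and group size $A=\frac{n-m}{n^{1-t}}$, where the parameters $(s,r,t)$ satisfy $0\le t<s<r<1$. Suppose that there is a constant $c>0$ such that for each positive integer $n$ there is an $(\alpha_n,\beta_n)$-controlled procedure with $\alpha_n=c\,n^{-\kappa_\alpha}$ and $\beta_n=c\,n^{-\kappa_\beta}$. Then $$\sqrt{s+\kappa_\alpha}+\sqrt{\kappa_\beta}\ \le\ \sqrt r.$$
   Context: $[n]=\{1,\dots,n\}$ is partitioned into a set $\mathcal{H}_0$ of nulls and a set $\mathcal{H}_1=\{i_1<\dots<i_m\}$ of signals. In the grouped dependence model with group size $A$, where $1\le A\le\min\{m,n/m\}$, each signal is matched with a different set of $A$ nulls: for each $1\le g\le m$ there is a set $\mathcal{H}_0^{(g)}\subseteq\mathcal{H}_0$ of $A$ nulls corresponding to the $g$-th signal, the sets for different $g$ being disjoint, and $\mathcal{H}_0^{(0)}=\mathcal{H}_0\setminus\bigcup_{g=1}^m\mathcal{H}_0^{(g)}$ is the set of independent nulls. The vector $W$ is generated as follows: $(W_i)_{i\in\mathcal{H}_1}\sim\mathcal{N}(0,I_m)$; given $(W_i)_{i\in\mathcal{H}_1}$, the $W_i$ with $i\in\mathcal{H}_0^{(0)}$ are independent $\mathcal{N}(0,1)$; and $W_i=W_{i_g}$ for $i\in\mathcal{H}_0^{(g)}$, $g=1,\dots,m$. The observed statistics are $X_i=W_i$ for $i\in\mathcal{H}_0$ and $X_i=W_i+\mu$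 for $i\in\mathcal{H}_1$. A top-$K$ procedure rejects the hypotheses corresponding to the top $K$ statistics, where $K=K_n(X_1,\dots,X_n)$ is a (possibly randomized) non-negative integer that may depend on the observed statistics; its discovery set is $\mathcal{I}=\{i\in[n]:X_i\ge X_{(K)}\}$, where $X_{(k)}$ is the $k$-th largest of $X_1,\dots,X_n$. Define $$\mathrm{FDR}=\mathbb{E}\Big[\frac{\mathrm{card}(\mathcal{I}\cap\mathcal{H}_0)}{\max\{\mathrm{card}(\mathcal{I}),1\}}\Big],\qquad \mathrm{FNR}=\mathbb{E}\Big[\frac{\mathrm{card}(\mathcal{I}^c\cap\mathcal{H}_1)}{\mathrm{card}(\mathcal{H}_1)}\Big].$$ For a pair $(\alpha,\beta)\in[0,1]\times[0,1]$, an $(\alpha,\beta)$-controlled procedure is a top-$K$ procedure with $\mathrm{FDR}\le\alpha$ and $\mathrm{FNR}\le\beta$. The exponents $\kappa_\alpha,\kappa_\beta$ are scalars not depending on $n$.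
   Formalization: When c=1 both exponents are assumed positive (otherwise rejecting nothing or everything is controlled and the claim fails); m and A are any integers within distance 1 of the given values, and control is assumed only for all n from some n0 on, as the model does not exist at n=1. *)

(* Defs.v *)
From HB Require Import structures.
From mathcomp Require Import all_boot all_order all_algebra.
From mathcomp Require Import all_classical all_reals all_analysis.

Set Implicit Arguments.
Unset Strict Implicit.
Unset Printing Implicit Defensive.

Import Order.TTheory GRing.Theory Num.Theory.
Import numFieldNormedType.Exports.

Local Open Scope ring_scope.

(* Hypotheses are indexed by 'I_n, i.e. 0, ..., n - 1. *)
Record grouping (n m A : nat) := Grouping {
  group_size_bounds : (1 <= A <= minn m (n %/ m))%N ;
  signal : 'I_m -> 'I_n ;
  signal_lt : {homo signal : g h / (g < h)%N} ;
  group : 'I_m -> {set 'I_n} ;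
  group_null : forall g, group g \subset ~: (signal @: [set: 'I_m]) ;
  card_group : forall g, #|group g| = A ;
  group_disjoint : forall g h, g != h -> group g :&: group h = finset.set0
}.

Definition signals n m A (D : grouping n m A) : {set 'I_n} :=
  signal D @: [set: 'I_m].

Definition nulls n m A (D : grouping n m A) : {set 'I_n} := ~: signals D.

Definition independent_nulls n m A (D : grouping n m A) : {set 'I_n} :=
  nulls D :\: \bigcup_(g : 'I_m) group D g.

(* [noise_law] is the joint law of the signal and the independent-null
   coordinates: the signal block is N(0, I_m) and, conditionally on it, the
   independent nulls are i.i.d. N(0, 1), i.e. the law of the two blocks together
   is the product of standard normals, characterised here on measurable
   rectangles.  A coordinate is left free by taking B i = setT. *)
Record grouped_model (R : realType) (n m A : nat) := GroupedModel {
  design : grouping n m A ;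
  noise_display : measure_display ;
  noise_space : measurableType noise_display ;
  noise_prob : probability noise_space R ;
  noise : 'I_n -> {RV noise_prob >-> R} ;
  noise_law : forall B : 'I_n -> set R, (forall i, measurable (B i)) ->
    noise_prob (\bigcap_(i in [set` signals design :|: independent_nulls design])
                  (noise i @^-1` B i))%classic =
    (\prod_(i in signals design :|: independent_nulls design)
        normal_prob 0 1 (B i))%E ;
  noise_group : forall (g : 'I_m) (i : 'I_n), i \in group design g ->
    forall w, noise i w = noise (signal design g) w
}.

Definition statistics (R : realType) n m A (M : grouped_model R n m A) (mu : R)
    (w : noise_space M) : n.-tuple R :=
  [tuple noise M i w + (if i \in signals (design M) then mu else 0) | i < n].

(* Conventions at the ends: X_(0) = +oo (so K = 0 rejects nothing), and
   X_(k) = -oo for k > n (so K >= n rejects everything). *)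
Definition order_stat (R : realType) n (x : n.-tuple R) (k : nat) : \bar R :=
  if k is j.+1 then nth -oo%E [seq y%:E | y <- sort >=%R x] j else +oo%E.

Definition discoveries (R : realType) n (x : n.-tuple R) (k : nat) : {set 'I_n} :=
  [set i | (order_stat x k <= (tnth x i)%:E)%E].

(* K = rule (X, U), where the seed U is independent of the statistics; a
   deterministic rule is one that ignores U. *)
Record topK_procedure (R : realType) (n : nat) := TopKProcedure {
  seed_display : measure_display ;
  seed_space : measurableType seed_display ;
  seed_prob : probability seed_space R ;
  rule : {mfun (n.-tuple R * seed_space)%type >-> nat}
}.

Section Risks.
Context (R : realType) (n m A : nat).
Variables (M : grouped_model R n m A) (mu : R) (T : topK_procedure R n).

Definition rejected (w : noise_space M * seed_space T) : {set 'I_n} :=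
  let x := statistics mu w.1 in discoveries x (rule T (x, w.2)).

Definition FDP (w : noise_space M * seed_space T) : R :=
  #|rejected w :&: nulls (design M)|%:R / (maxn #|rejected w| 1)%:R.

Definition FNP (w : noise_space M * seed_space T) : R :=
  #|~: rejected w :&: signals (design M)|%:R / #|signals (design M)|%:R.

Definition FDR : \bar R := 'E_(noise_prob M \x seed_prob T)[FDP]%E.

Definition FNR : \bar R := 'E_(noise_prob M \x seed_prob T)[FNP]%E.

Definition controlled (alpha beta : R) : Prop :=
  [/\ 0 <= alpha <= 1, 0 <= beta <= 1,
      (FDR <= alpha%:E)%E & (FNR <= beta%:E)%E].

End Risks.

(* Main.v *)
Require Import Defs.
From mathcomp Require Import all_boot all_order all_algebra.
From mathcomp Require Import all_classical all_reals all_analysis.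
From mathcomp Require Import measurable_realfun.
From mathcomp Require Import zify ring lra.
Set Implicit Arguments.
Unset Strict Implicit.
Unset Printing Implicit Defensive.
Import Order.TTheory GRing.Theory Num.Theory.
Import numFieldNormedType.Exports.
Local Open Scope ring_scope.

(* Fix a threshold tau.  The rejected set is an upper level set of X, so either it
   contains {X >= tau}, and then FDP >= N / (N + m) where N counts the independent
   nulls above tau, or it is contained in {X >= tau}, and then FNP >= F / m where
   F counts the signals below tau.  As N and F concentrate around their means a
   and m q (Chebyshev), taking expectations gives, for every theta in ]0, 1[,
     (1 + m / (theta a)) FDR + FNR / (theta q)
        >= 1 - 1 / ((1 - theta)^2 a) - 1 / ((1 - theta)^2 m q),
   however K depends on the data.  The grouped nulls can only increase the FDP,
   and there are only m A = o(n) of them.  With tau = v sqrt(2 log n), a is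
   n^(1 - v^2) and q is n^(- max(0, sqrt r - v)^2), up to n^o(1), so if
   sqrt r - sqrt kappa_b < v < sqrt(s + kappa_a) the left-hand side has a limit
   < 1, while the right-hand side tends to 1. *)

(** * Discovery sets as upper level sets *)

(** The entries above [a] form a prefix of a decreasing list. The default [-oo] keeps the
    equivalence true past the end of the list. *)
Lemma nth_sort_le (R : realType) (s : seq R) (k : nat) (a : R) :
  sorted >=%R s ->
  (nth -oo%E [seq y%:E | y <- s] k <= a%:E)%E = (count (> a) s <= k)%N.
Proof.
elim: s k => [|y s IHs] k ys /=; first by rewrite nth_nil leNye.
have [ay|ya] := ltP a y.
  case: k => [|k] /=; first by rewrite lee_fin leNgt ay.
  by rewrite IHs ?(path_sorted ys).
have s0 : count (> a) s = 0%N.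
  apply/eqP; rewrite eqn0Ngt -has_count -all_predC; apply/allP => z zs /=.
  rewrite -leNgt (le_trans _ ya)//.
  by have /allP := order_path_min (rev_trans le_trans) ys; apply.
case: k => [|k] /=; first by rewrite s0 lee_fin ya.
by rewrite IHs ?(path_sorted ys)// s0.
Qed.

(** Removes sorting from the definition: the number of strictly larger statistics is visibly a
    measurable function of the data. Tied statistics share the same fate. *)
Lemma mem_discoveries (R : realType) n (x : n.-tuple R) (k : nat) (i : 'I_n) :
  (i \in discoveries x k) = (\sum_(j < n) (tnth x i < tnth x j)%R < k)%N.
Proof.
rewrite inE; case: k => [|k] /=; first by rewrite ltn0.
rewrite ltnS nth_sort_le ?(sort_sorted (@ge_total _ R))//.
rewrite (permP (permEl (perm_sort _ _))) -sum1_count big_mkcond big_tuple.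
by congr (_ <= _)%N; apply: eq_bigr => j _; case: (_ < _).
Qed.

(** Two upper level sets of [x] are nested. Nothing is asked of [k], so it may depend on the
    data. *)
Lemma discoveries_threshold (R : realType) n (x : n.-tuple R) (k : nat) (a : R) :
  [set i | a <= tnth x i] \subset discoveries x k \/
  discoveries x k \subset [set i | a <= tnth x i].
Proof.
have [xa|ax] := leP (order_stat x k) a%:E; [left|right]; apply/fintype.subsetP => i;
  rewrite !inE => h.
  by rewrite (le_trans xa)// lee_fin.
by rewrite -lee_fin (le_trans (ltW ax)).
Qed.

(** * Measurability of the discovery set and of its functions *)

Section measurability.
Context d (T : measurableType d).

Lemma measurable_fun_sum_nat I (r : seq I) (f : I -> T -> nat) :
  (forall i, measurable_fun setT (f i)) ->
  measurable_fun setT (fun w => \sum_(i <- r) f i w)%N.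
Proof.
move=> mf; elim: r => [|i r IHr].
  by under eq_fun do rewrite big_nil; exact: measurable_cst.
under eq_fun do rewrite big_cons.
exact: measurable_fun_addn.
Qed.

(** No condition on [f] is required: a preimage is a finite union, over the possible values [B] of
    [S], of finite intersections of membership events and their complements. *)
Lemma measurable_finset_fun (I : finType) d' (T' : measurableType d')
    (S : T -> {set I}) (f : {set I} -> T') :
  (forall i, measurable [set w | i \in S w]%classic) ->
  measurable_fun setT (f \o S).
Proof.
move=> mS _ Y mY; rewrite setTI.
rewrite (_ : _ @^-1` _ = \bigcup_(B in [set B : {set I} | Y (f B)])
    \bigcap_(i in [set: I])
       (if i \in B then [set w | i \in S w] else ~` [set w | i \in S w]))%classic.
  apply: fin_bigcup_measurable => // B _; apply: fin_bigcap_measurable => // i _.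
  by case: ifP => _ //; exact: measurableC.
apply/seteqP; split=> [w /= Yw|w [B /= YB BS]].
  exists (S w) => // i _ /=; case: ifPn => //= /negP; exact.
suff -> : S w = B by [].
apply/finset.setP => i; have := BS i Logic.I.
by case: ifPn => //= _ /negP/negbTE.
Qed.

End measurability.

Lemma measurable_discoveries (R : realType) n d (T : measurableType d)
    (X : T -> n.-tuple R) (K : T -> nat) (i : 'I_n) :
  measurable_fun setT X -> measurable_fun setT K ->
  measurable [set w | i \in discoveries (X w) (K w)]%classic.
Proof.
move=> /measurable_fun_tnthP mX mK.
rewrite (_ : [set _ | _]%classic =
   (fun w => \sum_(j < n) (tnth (X w) i < tnth (X w) j)%R < K w)%N
     @^-1` [set true])%classic.
  rewrite -[X in measurable X]setTI; apply: measurable_fun_ltn => //.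
  apply: measurable_fun_sum_nat => j.
  apply: (@measurableT_comp _ _ _ _ _ _ nat_of_bool) => //.
  apply: measurable_fun_ltr; exact: mX.
by apply/seteqP; split => w /=; rewrite mem_discoveries.
Qed.

(** * Chebyshev bound for a count of events *)

Section count_concentration.
Context d (T : measurableType d) (R : realType) (P : probability T R).

Lemma integral_sum_indic (I : finType) (Q : pred I) (A : I -> set T) :
  (forall i, measurable (A i)) ->
  (\int[P]_w (\sum_(i | Q i) \1_(A i) w)%:E = \sum_(i | Q i) P (A i))%E.
Proof.
move=> mA; under eq_integral do rewrite -sumEFin -big_filter.
rewrite ge0_integral_sum//.
- by rewrite big_filter; apply: eq_bigr => i _; rewrite integral_indic// setIT.
- by move=> i; apply/measurable_EFinP; exact: measurable_indic.
Qed.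

(** Pairwise independence bounds the variance of the count by its mean [a], so a deviation of
    [(1 - theta) * a] has probability at most [a / ((1 - theta) * a) ^ 2]. *)
Lemma count_lower_tail (I : finType) (S : {set I}) (B : I -> set T) (p theta : R) :
  (forall i, measurable (B i)) -> 0 < p -> 0 <= theta < 1 -> (0 < #|S|)%N ->
  (forall i, i \in S -> P (B i) = p%:E) ->
  (forall i j, i \in S -> j \in S -> i != j -> P (B i `&` B j)%classic = (p ^+ 2)%:E) ->
  (P [set w | \sum_(i in S) \1_(B i) w < theta * (#|S|%:R * p)]%R%classic <=
    (((1 - theta) ^+ 2 * (#|S|%:R * p))^-1)%:E)%E.
Proof.
move=> mB p0 /andP[th0 th1] S0 PB PBB.
pose N w : R := \sum_(i in S) \1_(B i) w.
set a := #|S|%:R * p.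
have a0 : 0 < a by rewrite mulr_gt0// ltr0n.
have mN : measurable_fun setT N.
  rewrite /N; under eq_fun do rewrite -big_filter.
  by apply: measurable_sum => i; exact: measurable_indic.
have N0 w : 0 <= N w by rewrite sumr_ge0.
set E := [set w | _]%classic.
have mE : measurable E.
  rewrite /E -[X in measurable X]setTI (_ : [set w | _]%classic =
    (fun w => N w < theta * a) @^-1` [set true])%classic.
    exact: measurable_fun_ltr.
  by apply/seteqP; split => w.
have intN : (\int[P]_w (N w)%:E = a%:E)%E.
  rewrite integral_sum_indic// (eq_bigr (fun=> p%:E)) ?sumEFin//.
  by rewrite sumr_const /a mulr_natl.
have intN2 : (\int[P]_w (N w ^+ 2)%:E <= (a + a ^+ 2)%:E)%E.
  (* The square is a sum over pairs of indicators of intersections. In each row the diagonal pair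
     contributes [p] and the others together at most [p * a]. *)
  under eq_integral => w _ do
    rewrite expr2 mulr_suml; under eq_integral => w _ do
    under eq_bigr => i _ do rewrite mulr_sumr.
  under eq_integral => w _.
    rewrite pair_big /=.
    under eq_bigr => i _.
      rewrite (_ : _ * _ = \1_(B i.1 `&` B i.2)%classic w); last by rewrite indicI.
    over.
  over.
  rewrite (integral_sum_indic _ (A := fun i => B i.1 `&` B i.2)%classic); last first.
    by move=> i; exact: measurableI.
  rewrite -(pair_big (fun i => i \in S) (fun i => i \in S)
    (fun i j => P (B i `&` B j)))%classic /=.
  apply: (@le_trans _ _ (\sum_(i in S) (p + p * a)%:E)%E); last first.
    by rewrite sumEFin sumr_const lee_fin -mulr_natl /a; lra.
  apply: lee_sum => i iS; rewrite (bigD1 i)//= setIid PB//.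
  rewrite EFinD leeD2l// (eq_bigr (fun=> (p ^+ 2)%:E)); last first.
    by move=> j /andP[jS ji]; rewrite PBB// eq_sym.
  rewrite sumEFin sumr_const lee_fin -mulr_natl /a expr2 mulrCA ler_pM2l//.
  rewrite ler_pM2r// ler_nat subset_leq_card//.
  by apply/fintype.subsetP => j /andP[].
(* Chebyshev's inequality with all terms moved so that every integrand is
   nonnegative. *)
set c := ((1 - theta) * a) ^+ 2.
have c0 : 0 <= c by exact: sqr_ge0.
have a20 : 0 <= 2 * a by apply: mulr_ge0 => //; exact: ltW.
have : (\int[P]_w (c * \1_E w + 2 * a * N w)%:E <=
        \int[P]_w (N w ^+ 2 + a ^+ 2)%:E)%E.
  apply: ge0_le_integral => //.
  - move=> w _; rewrite lee_fin; apply: addr_ge0; first exact: mulr_ge0.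
    exact: mulr_ge0.
  - by apply/measurable_EFinP/measurable_funD; apply: measurable_funM.
  - apply/measurable_EFinP/measurable_funD => //.
    exact: measurable_funX.
  move=> w _; rewrite lee_fin indicE.
  have [|] := boolP (w \in E); rewrite ?inE /= => Ew; last first.
    by have := sqr_ge0 (N w - a); rewrite mulr0; nra.
  rewrite mulr1 /c.
  have : (1 - theta) * a <= a - N w 
    by rewrite mulrBl mul1r lerB// ltW.
  have : 0 <= (1 - theta) * a by rewrite mulr_ge0 ?subr_ge0// ltW.
  nra.
under eq_integral do rewrite EFinD (EFinM c) (EFinM (2 * a)).
under [X in (_ <= X)%E]eq_integral do rewrite EFinD.
rewrite ge0_integralD//; last 4 first.
- by move=> w _; rewrite lee_fin; apply: mulr_ge0.
- apply: measurable_funeM; apply/measurable_EFinP; exact: measurable_indic.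
- by move=> w _; apply: mule_ge0; rewrite lee_fin.
- by apply: measurable_funeM; apply/measurable_EFinP.
rewrite !ge0_integralZl ?lee_fin//; last 3 first.
- exact/measurable_EFinP.
- by move=> w _; rewrite lee_fin.
- exact/measurable_EFinP/measurable_indic.
rewrite ge0_integralD//; last 3 first.
- by move=> w _; rewrite lee_fin sqr_ge0.
- by apply/measurable_EFinP; apply: measurable_funX.
- by move=> w _; rewrite lee_fin sqr_ge0.
rewrite integral_indic// setIT intN integral_cst//= probability_setT mule1.
have PEfin : P E \is a fin_num by rewrite fin_num_measure.
rewrite -(fineK PEfin) => h.
have := le_trans h (leeD2r (a ^+ 2)%:E intN2).
rewrite -EFinM -EFinM -!EFinD !lee_fin /c => {}h.
rewrite -[leRHS]mul1r ler_pdivlMr; last by rewrite mulr_gt0// exprn_gt0// subr_gt0.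
rewrite -(ler_pM2r a0); lra.
Qed.

End count_concentration.

Lemma sum_indic_le_card (R : realType) T (I : finType) (S S' : {set I})
    (B : I -> set T) (w : T) :
  (forall i, i \in S -> B i w -> i \in S') ->
  \sum_(i in S) \1_(B i) w <= #|S'|%:R :> R.
Proof.
move=> BS'; rewrite -sum1_card natr_sum big_mkcond [leRHS]big_mkcond /=.
apply: ler_sum => i _; rewrite indicE.
case: ifPn => [iS|_]; last by case: ifP.
case: ifPn => [_|iS']; first by rewrite lern1 leq_b1.
rewrite (_ : (w \in B i) = false)//.
by apply/negP => /set_mem /(BS' _ iS); rewrite (negbTE iS').
Qed.

(** * Joint law of signals and independent nulls *)

Section grouped_model.
Context (R : realType) (n m A : nat) (M : grouped_model R n m A).
Let D := design M.
Let free := signals D :|: independent_nulls D.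

Lemma card_signals : #|signals D| = m.
Proof.
rewrite card_imset ?cardsT ?card_ord// => g h gh.
have [lt_gh|lt_hg|/val_inj//] := ltngtP g h.
- by have := signal_lt D lt_gh; rewrite gh ltnn.
- by have := signal_lt D lt_hg; rewrite gh ltnn.
Qed.

(** A marginal is read off [noise_law] by giving every other coordinate the full set; pairs are
    treated likewise below. *)
Lemma noise_prob1 (i : 'I_n) (B : set R) : i \in free -> measurable B ->
  noise_prob M (noise M i @^-1` B)%classic = normal_prob 0 1 B.
Proof.
move=> ifree mB.
have := @noise_law _ _ _ _ M (fun k => if k == i then B else setT).
rewrite (bigD1 i)//= eqxx big1 => [|j /andP[_ /negbTE ->]]; last first.
  exact: probability_setT.
rewrite mule1 => <-; last by move=> j; case: ifP.
congr (noise_prob M _); apply/seteqP; split => [w /= iw j _ /=|w]; last first.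
  by move=> /(_ i ifree) /=; rewrite eqxx.
by case: ifP => // /eqP ->.
Qed.

Lemma noise_prob2 (i j : 'I_n) (B : set R) : i \in free -> j \in free -> i != j ->
  measurable B ->
  noise_prob M (noise M i @^-1` B `&` noise M j @^-1` B)%classic =
  (normal_prob 0 1 B * normal_prob 0 1 B)%E.
Proof.
move=> ifree jfree ij mB.
have := @noise_law _ _ _ _ M (fun k => if (k == i) || (k == j) then B else setT).
rewrite (bigD1 i)//= eqxx (bigD1 j) ?jfree ?(eq_sym j) ?ij//= eqxx orbT.
rewrite big1 => [|k]; last first.
  by move=> /andP[/andP[_ /negbTE ->] /negbTE ->]; exact: probability_setT.
rewrite mule1 => <-; last by move=> k; case: ifP.
congr (noise_prob M _); apply/seteqP; split => [w /= [iw jw] k _ /=|w].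
  by case: ifP => // /orP[] /eqP ->.
move=> h; split.
  by have := h i ifree; rewrite /= eqxx.
by have := h j jfree; rewrite /= eqxx orbT.
Qed.

Lemma noise_count_lower_tail (S : {set 'I_n}) (B : set R) (p theta : R) :
  S \subset free -> (0 < #|S|)%N -> measurable B ->
  normal_prob 0 1 B = p%:E -> 0 < p -> 0 <= theta < 1 ->
  (noise_prob M [set w | \sum_(i in S) \1_(noise M i @^-1` B)%classic w
      < theta * (#|S|%:R * p)]%R%classic <=
    (((1 - theta) ^+ 2 * (#|S|%:R * p))^-1)%:E)%E.
Proof.
move=> /fintype.subsetP Sfree S0 mB Bp p0 th.
apply: count_lower_tail => //.
- by move=> i; rewrite -[X in measurable X]setTI; exact: measurable_funP.
- by move=> i /Sfree iS; rewrite noise_prob1.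
- by move=> i j /Sfree iS /Sfree jS ij; rewrite noise_prob2// Bp -EFinM expr2.
Qed.

End grouped_model.

(** * Trade-off between FDR and FNR at a fixed threshold *)

Section risk_tradeoff.
Context (R : realType) (n m A : nat) (M : grouped_model R n m A).
Context (mu : R) (T : topK_procedure R n).
Let D := design M.

Lemma FDP_ge0 w : 0 <= FDP (M := M) mu (T := T) w.
Proof. by rewrite /FDP divr_ge0. Qed.

Lemma FNP_ge0 w : 0 <= FNP (M := M) mu (T := T) w.
Proof. by rewrite /FNP divr_ge0. Qed.

Lemma measurable_mem_rejected i :
  measurable [set w | i \in rejected (M := M) mu (T := T) w]%classic.
Proof.
have mstat : measurable_fun setT (fun w : noise_space M * seed_space T =>
    statistics mu w.1).
  apply/measurable_fun_tnthP => j.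
  under [X in measurable_fun _ X]eq_fun do rewrite /= tnth_mktuple.
  apply: measurable_funD => //.
  exact: measurableT_comp.
apply: (measurable_discoveries i (X := fun w => statistics mu w.1)
   (K := fun w => rule T (statistics mu w.1, w.2))) => //.
apply: measurableT_comp => //.
exact: measurable_fun_pair.
Qed.

Lemma measurable_FDP : measurable_fun setT (FDP (M := M) mu (T := T)).
Proof.
exact: (measurable_finset_fun
  (fun S : {set 'I_n} => #|S :&: nulls (design M)|%:R / (maxn #|S| 1)%:R : R)
  measurable_mem_rejected).
Qed.

Lemma measurable_FNP : measurable_fun setT (FNP (M := M) mu (T := T)).
Proof.
exact: (measurable_finset_fun
  (fun S : {set 'I_n} =>
     #|~: S :&: signals (design M)|%:R / #|signals (design M)|%:R : R)
  measurable_mem_rejected).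
Qed.

(** The pathwise form of the trade-off. The weights are such that, whichever way the discovery set
    is nested with the level set at [tau], one of the two terms alone reaches 1. *)
Lemma FDP_FNP_tradeoff (w : noise_space M * seed_space T) (tau a b : R) :
  (0 < m)%N -> 0 < a -> 0 < b ->
  a <= \sum_(i in independent_nulls D)
          \1_(noise M i @^-1` `[tau, +oo[)%classic w.1 ->
  b * m%:R <= \sum_(i in signals D)
          \1_(noise M i @^-1` `]-oo, tau - mu[)%classic w.1 ->
  1 <= (1 + m%:R / a) * FDP mu w + b^-1 * FNP mu w.
Proof.
move=> m0 a0 b0 aN bF.
have m0R : 0 < m%:R :> R by rewrite ltr0n.
have [sub|sub] := discoveries_threshold (statistics mu w.1)
    (rule T (statistics mu w.1, w.2)) tau; move/fintype.subsetP in sub.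
- apply: (@le_trans _ _ ((1 + m%:R / a) * FDP mu w)); last first.
    by rewrite lerDl mulr_ge0 ?FNP_ge0// invr_ge0 ltW.
  rewrite /FDP; set S := rejected mu w.
  have aS : a <= #|S :&: nulls D|%:R.
    rewrite (le_trans aN)//; apply: sum_indic_le_card => i iN /=.
    rewrite in_itv/= andbT => tw.
    have iN' : i \in nulls D by move: iN; rewrite inE => /andP[].
    rewrite inE iN' andbT; apply: sub; rewrite inE tnth_mktuple.
    by move: iN'; rewrite inE => /negbTE ->; rewrite addr0.
  have Sm : (#|S| <= #|S :&: nulls D| + m)%N.
    rewrite -(cardsID (nulls D) S) leq_add2l.
    rewrite -[X in (_ <= X)%N](card_signals M); apply/subset_leq_card.
    by apply/fintype.subsetP => i; rewrite !inE => /andP[]; rewrite negbK.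
  have S0 : (0 < #|S :&: nulls D|)%N by rewrite -(ltr0n R) (lt_le_trans a0).
  have S1 : (0 < #|S|)%N.
    by apply: (leq_trans S0); apply/subset_leq_card; exact: finset.subsetIl.
  rewrite (maxn_idPl S1).
  rewrite mulrA ler_pdivlMr ?ltr0n// mul1r.
  (* With at least [a] false discoveries, the [m] possible true ones number at most [m / a] times
     the false ones. *)
  apply: (@le_trans _ _ (#|S :&: nulls D|%:R + m%:R)).
    by rewrite -natrD ler_nat.
  rewrite mulrDl mul1r lerD2l mulrAC -mulrA ler_peMr ?ler0n//.
  by rewrite ler_pdivlMr// mul1r.
- apply: (@le_trans _ _ (b^-1 * FNP mu w)); last first.
    rewrite lerDr mulr_ge0 ?FDP_ge0// addr_ge0// divr_ge0// ltW//.
  rewrite /FNP; set S := rejected mu w.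
  rewrite ler_pdivlMl// mulr1 (card_signals M) ler_pdivlMr// (le_trans bF)//.
  apply: sum_indic_le_card => i iS /=; rewrite in_itv/= => itau.
  rewrite finset.in_setI finset.in_setC iS andbT; apply/negP => iR.
  have := sub i iR; rewrite inE tnth_mktuple iS.
  by rewrite leNgt -ltrBrDr itau.
Qed.

(** The pathwise inequality is integrated over noise and seed; the last two terms pay for the events
    where a count falls below [theta] times its mean. *)
Lemma risk_tradeoff (tau p q theta : R) :
  (0 < m)%N -> (0 < #|independent_nulls D|)%N ->
  normal_prob 0 1 `[tau, +oo[%classic = p%:E -> 0 < p ->
  normal_prob 0 1 `]-oo, tau - mu[%classic = q%:E -> 0 < q ->
  0 < theta < 1 ->
  (1 <= (1 + m%:R / (theta * (#|independent_nulls D|%:R * p)))%:E * FDR M mu T +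
    ((theta * q)^-1)%:E * FNR M mu T +
    (((1 - theta) ^+ 2 * (#|independent_nulls D|%:R * p))^-1 +
     ((1 - theta) ^+ 2 * (m%:R * q))^-1)%:E)%E.
Proof.
move=> m0 n0 tp p0 tq q0 /andP[th0 th1].
set a := #|independent_nulls D|%:R * p.
have a0 : 0 < a by rewrite mulr_gt0// ltr0n.
pose N := fun w => \sum_(i in independent_nulls D)
          \1_(noise M i @^-1` `[tau, +oo[)%classic w : R.
pose F := fun w => \sum_(i in signals D)
          \1_(noise M i @^-1` `]-oo, tau - mu[)%classic w : R.
pose EN := [set w | N w < theta * a]%classic.
pose EF := [set w | F w < theta * (m%:R * q)]%classic.
have mcount (S : {set 'I_n}) (B : set R) (c : R) : measurable B ->
    measurable [set w | \sum_(i in S) \1_(noise M i @^-1` B)%classic w < c]%classic.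
  move=> mB; rewrite -[X in measurable X]setTI (_ : [set w | _]%classic =
    (fun w => \sum_(i in S) \1_(noise M i @^-1` B)%classic w < c)
       @^-1` [set true])%classic; last by apply/seteqP; split => w.
  apply: measurable_fun_ltr => //.
  under eq_fun do rewrite -big_filter.
  apply: measurable_sum => i; apply: measurable_indic.
  by rewrite -[X in measurable X]setTI; exact: measurable_funP.
have mEN : measurable EN by exact: mcount.
have mEF : measurable EF by exact: mcount.
have PEN : (noise_prob M EN <= (((1 - theta) ^+ 2 * a)^-1)%:E)%E.
  by apply: noise_count_lower_tail => //; rewrite ?finset.subsetUr// th1 ltW.
have PEF : (noise_prob M EF <= (((1 - theta) ^+ 2 * (m%:R * q))^-1)%:E)%E.
  have := @noise_count_lower_tail _ _ _ _ M (signals D) `]-oo, tau - mu[%classic q theta.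
  rewrite (card_signals M); apply => //; first exact: finset.subsetUl.
  by rewrite th1 ltW.
pose PQ := (noise_prob M \x seed_prob T)%E.
have PQ_fst (E : set (noise_space M)) : measurable E ->
    (PQ (E `*` setT)%classic = noise_prob M E)%E.
  by move=> mE; rewrite /PQ product_measure1E//= probability_setT mule1.
have mfst (E : set (noise_space M)) : measurable E ->
    measurable (E `*` [set: seed_space T])%classic.
  by move=> mE; exact: measurableX.
have ge0c : 0 <= 1 + m%:R / (theta * a).
  by rewrite addr_ge0// divr_ge0// mulr_ge0// ltW.
have ge0q : 0 <= (theta * q)^-1 by rewrite invr_ge0 mulr_ge0// ltW.
have int1 : (\int[PQ]_w 1%:E = 1)%E.
  rewrite integral_cst// -setXTT mul1e.
  by apply: etrans (PQ_fst _ _) _ => //; exact: probability_setT.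
(* Adding the indicators of the exceptional events [EN] and [EF] makes the bound hold at every [w].
   These events do not involve the seed. *)
have : (\int[PQ]_w 1%:E <= \int[PQ]_w
   ((1 + m%:R / (theta * a))%:E * (FDP mu w)%:E +
     ((theta * q)^-1)%:E * (FNP mu w)%:E +
    ((\1_(EN `*` setT)%classic w)%:E + (\1_(EF `*` setT)%classic w)%:E)))%E.
  apply: ge0_le_integral => //.
  - apply: emeasurable_funD; apply: emeasurable_funD.
    + by apply: measurable_funeM; apply/measurable_EFinP; exact: measurable_FDP.
    + by apply: measurable_funeM; apply/measurable_EFinP; exact: measurable_FNP.
    + by apply/measurable_EFinP/measurable_indic; exact: mfst.
    + by apply/measurable_EFinP/measurable_indic; exact: mfst.
  move=> w _; rewrite -!EFinM -!EFinD lee_fin.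
  have [wEN|wEN] := boolP (w \in EN `*` setT)%classic.
    rewrite [\1_(EN `*` setT)%classic w]indicE wEN /=.
    by rewrite addrCA lerDl !addr_ge0 ?mulr_ge0 ?FDP_ge0 ?FNP_ge0.
  have [wEF|wEF] := boolP (w \in EF `*` setT)%classic.
    rewrite [\1_(EF `*` setT)%classic w]indicE wEF /=.
    by rewrite addrA lerDr !addr_ge0 ?mulr_ge0 ?FDP_ge0 ?FNP_ge0.
  rewrite -[leLHS]addr0 lerD ?addr_ge0//.
  apply: (FDP_FNP_tradeoff (tau := tau)) => //; [exact: mulr_gt0|exact: mulr_gt0| |].
    by rewrite leNgt; apply: contra wEN => h; rewrite inE.
  by rewrite -mulrA [q * _]mulrC leNgt; apply: contra wEF => h; rewrite inE.
have mFDP : measurable_fun setT (fun w => (FDP (M := M) mu (T := T) w)%:E).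
  by apply/measurable_EFinP; exact: measurable_FDP.
have mFNP : measurable_fun setT (fun w => (FNP (M := M) mu (T := T) w)%:E).
  by apply/measurable_EFinP; exact: measurable_FNP.
have mind (E : set (noise_space M)) : measurable E ->
    measurable_fun setT (fun w => (\1_(E `*` [set: seed_space T])%classic w : R)%:E).
  by move=> mE; apply/measurable_EFinP/measurable_indic; exact: mfst.
have intE (E : set (noise_space M)) : measurable E ->
    (\int[PQ]_w (\1_(E `*` [set: seed_space T])%classic w : R)%:E = noise_prob M E)%E.
  move=> mE; rewrite integral_indic ?setIT;
    [exact: PQ_fst|exact: measurableT|exact: mfst].
rewrite ge0_integralD//; last 4 first.
- by move=> w _; rewrite -!EFinM -EFinD lee_fin addr_ge0 ?mulr_ge0 ?FDP_ge0 ?FNP_ge0.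
- by apply: emeasurable_funD; exact: measurable_funeM.
- by move=> w _; rewrite -EFinD lee_fin addr_ge0.
- by apply: emeasurable_funD; exact: mind.
rewrite ge0_integralD//; last 4 first.
- by move=> w _; rewrite -!EFinM lee_fin mulr_ge0 ?FDP_ge0.
- exact: measurable_funeM.
- by move=> w _; rewrite -!EFinM lee_fin mulr_ge0 ?FNP_ge0.
- exact: measurable_funeM.
rewrite ge0_integralD//; [|exact: mind|exact: mind].
rewrite !ge0_integralZl ?lee_fin//; last 2 first.
- by move=> w _; rewrite lee_fin FNP_ge0.
- by move=> w _; rewrite lee_fin FDP_ge0.
rewrite !intE// int1.
move=> /le_trans; apply; rewrite /FDR /FNR unlock leeD2l//.
by rewrite EFinD leeD.
Qed.

Lemma controlled_tradeoff (alpha beta tau p q theta : R) :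
  controlled M mu T alpha beta ->
  (0 < m)%N -> (0 < #|independent_nulls D|)%N ->
  normal_prob 0 1 `[tau, +oo[%classic = p%:E -> 0 < p ->
  normal_prob 0 1 `]-oo, tau - mu[%classic = q%:E -> 0 < q ->
  0 < theta < 1 ->
  1 <= (1 + m%:R / (theta * (#|independent_nulls D|%:R * p))) * alpha +
    (theta * q)^-1 * beta +
    (((1 - theta) ^+ 2 * (#|independent_nulls D|%:R * p))^-1 +
     ((1 - theta) ^+ 2 * (m%:R * q))^-1).
Proof.
move=> [_ _ fdr fnr] m0 n0 tp p0 tq q0 th.
have /andP[th0 th1] := th.
rewrite -lee_fin (le_trans (risk_tradeoff m0 n0 tp p0 tq q0 th))//.
rewrite [leRHS]EFinD leeD2r// [leRHS]EFinD !(EFinM _ alpha) !(EFinM _ beta).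
apply: leeD; apply: lee_wpmul2l => //; rewrite lee_fin.
  by rewrite addr_ge0// divr_ge0// !mulr_ge0// ltW.
by rewrite invr_ge0 mulr_ge0// ltW.
Qed.

End risk_tradeoff.

(** Union bounds on signals and groups, stated with sums to avoid truncated subtraction. *)
Lemma card_independent_nulls n m A (D : grouping n m A) :
  (n <= #|independent_nulls D| + m + m * A)%N.
Proof.
have cS : (#|signals D| <= m)%N.
  by rewrite (leq_trans (leq_imset_card _ _))// cardsT card_ord.
have cG : (#|\bigcup_(g : 'I_m) group D g| <= m * A)%N.
  apply: (@leq_trans (\sum_(g < m) #|group D g|)).
    elim/big_ind2 : _ => [|B k C l Bk Cl|//]; first by rewrite cards0.
    by rewrite (leq_trans (leq_card_setU _ _))// leq_add.
  by rewrite (eq_bigr (fun=> A)) ?sum_nat_const ?card_ord// => g _; exact: card_group.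
have cI : (#|nulls D :&: \bigcup_(g : 'I_m) group D g| <= m * A)%N.
  by rewrite (leq_trans _ cG)//; apply/subset_leq_card; exact: finset.subsetIr.
have := cardsID (\bigcup_(g : 'I_m) group D g) (nulls D).
have := cardsC (signals D); rewrite card_ord -/(nulls D) -/(independent_nulls D).
lia.
Qed.

(** * Bounds for the standard normal law *)

Section gaussian.
Context (R : realType).
Implicit Types x y b u v : R.

(** The interval has length at least 1 and lies in [[-b, b]], where the density is at least its
    value at [b]. *)
Lemma normal_prob_itv_lb x y b : - b <= x -> x + 1 <= y -> y <= b ->
  ((normal_peak 1 * expR (- (b ^+ 2 / 2)))%:E <=
   normal_prob 0 1 `[x, y[%classic)%E.
Proof.
move=> bx xy yb; set c := _ * _.
have c0 : 0 <= c by rewrite mulr_ge0 ?normal_peak_ge0 ?expR_ge0.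
apply: (@le_trans _ _ (\int[lebesgue_measure]_(x in `[x, y[%classic) c%:E)%E).
  rewrite integral_cst//= lebesgue_measure_itv/= lte_fin ifT; last lra.
  by rewrite -EFinB -EFinM lee_fin ler_peMr//; lra.
apply: ge0_le_integral => //=.
- apply/measurable_EFinP; apply: measurable_funTS; exact: measurable_normal_pdf.
move=> z; rewrite in_itv/= => /andP[xz zy].
rewrite lee_fin normal_pdfE// ler_wpM2l ?normal_peak_ge0// ler_expR subr0.
rewrite expr1n mulNr lerN2 ler_pM2r ?invr_gt0//.
have : 0 <= (b - z) * (b + z) by apply: mulr_ge0; lra.
lra.
Qed.

Lemma normal_prob_Nyo_cvg1 (eps : R) : 0 < eps ->
  exists x0, forall x, x0 <= x -> 1 - eps <= fine (normal_prob 0 1 `]-oo, x[%classic).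
Proof.
move=> e0; pose X : {RV normal_prob (0 : R) 1 >-> R} :=
  @mfun_Sub _ _ (measurableTypeR R) R idfun (mem_set (@measurable_id _ _ setT)).
have := cvg_cdfy1 X => /fine_cvgP[_].
move=> /cvgrPdist_le /(_ _ e0) [x1 [_ h]].
(* The cdf measures closed rays: stepping back by 1 fits one inside []-oo, x[], and the 2 keeps
   [x - 1] strictly beyond [x1]. *)
exists (x1 + 2) => x x12.
have := h (x - 1); rewrite ltrBrDr => /(_ _)/= h1.
have {}h1 := h1 ltac:(lra).
rewrite preimage_id in h1.
apply: (@le_trans _ _ (fine (normal_prob 0 1 `]-oo, x - 1]%classic))).
  by have := le_trans (ler_norm _) h1; rewrite lerBlDr; lra.
rewrite fine_le ?fin_num_measure// le_measure ?inE//=.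
by move=> z /=; rewrite !in_itv/= => zx; rewrite (le_lt_trans zx)// gtrBl.
Qed.

End gaussian.

(** * Gaussian tails as powers of n *)

Section asymptotics.
Context (R : realType).
Local Open Scope classical_set_scope.
Local Open Scope ring_scope.
Implicit Types a c eps u v K : R.

Lemma near_natr_powRN_lt c a eps : 0 < a -> 0 < eps ->
  \forall n \near \oo, c * n%:R `^ (- a) < eps.
Proof.
move=> a0 eps0; have [c0|c0] := leP c 0.
  by near=> n; rewrite (le_lt_trans _ eps0)// mulr_le0_ge0 ?powR_ge0.
(* Solves [K ^ a = 2 * c / eps]; the factor 2 makes the final inequality strict. *)
pose K := (2 * c / eps) `^ a^-1.
have Kge : \forall n \near \oo, Num.max 1 K <= n%:R by exact: nbhs_infty_ger.
near=> n; have : Num.max 1 K <= n%:R by near: n.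
rewrite ge_max => /andP[n1 Kn].
rewrite powRN -ltr_pdivlMr ?invr_gt0 ?powR_gt0 ?(lt_le_trans _ n1)// invrK.
have KE : K `^ a = 2 * c / eps.
  have ceps : 0 <= 2 * c / eps by apply: divr_ge0; lra.
  by rewrite /K -powRrM mulVf ?gt_eqF// powRr1.
have : K `^ a <= n%:R `^ a by rewrite ge0_ler_powR// ?nnegrE ?powR_ge0// ltW.
rewrite KE ler_pdivrMr// => h; rewrite mulrC (lt_le_trans _ h)// ltr_pMl// ltr1n.
Unshelve. all: by end_near. Qed.

(** Covers error terms whose exponent may vanish, in which case the term is the constant [c]. *)
Lemma near_natr_powRN_lt_ge0 c a eps : 0 <= a -> 0 < eps -> (a = 0 -> c < eps) ->
  \forall n \near \oo, c * n%:R `^ (- a) < eps.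
Proof.
rewrite le_eqVlt => /predU1P[<- _ /(_ erefl) ceps|a0 eps0 _].
  by near=> n; rewrite oppr0 powRr0 mulr1.
exact: near_natr_powRN_lt.
Unshelve. all: by end_near. Qed.

(** The natural unit of length: at [v * sqrt2ln n] the normal density is [n ^ (- v ^ 2)] up to a
    constant, and the shift [mu] is [sqrt r] units. *)
Definition sqrt2ln (n : nat) : R := Num.sqrt (2 * ln n%:R).

Lemma near_sqrt2ln_ge K : \forall n \near \oo, K <= sqrt2ln n.
Proof.
have : \forall n \near \oo, expR (K ^+ 2) <= n%:R by exact: nbhs_infty_ger.
apply: filterS => n Kn; rewrite (le_trans (ler_norm _))// -sqrtr_sqr ler_wsqrtr//.
have n0 : 0 < n%:R :> R by rewrite (lt_le_trans _ Kn)// expR_gt0.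
have : K ^+ 2 <= ln n%:R by rewrite -[leLHS]expRK ler_ln ?posrE// expR_gt0.
have := sqr_ge0 K; lra.
Qed.

Lemma expR_sqr_sqrt2ln v n : (0 < n)%N ->
  expR (- ((v * sqrt2ln n) ^+ 2 / 2)) = n%:R `^ (- v ^+ 2).
Proof.
move=> n0; rewrite /powR pnatr_eq0 gtn_eqF//; congr expR.
rewrite exprMn sqr_sqrtr; first lra.
by rewrite mulr_ge0// ln_ge0// ler1n.
Qed.

Lemma near_sqrt2ln_gap u v : u < v ->
  \forall n \near \oo, u * sqrt2ln n + 1 <= v * sqrt2ln n.
Proof.
move=> uv; have vu : 0 < v - u by rewrite subr_gt0.
apply: filterS (near_sqrt2ln_ge (v - u)^-1) => n.
by rewrite -(ler_pM2l vu) divff ?gt_eqF// mulrBl; lra.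
Qed.

(** For large [n] the points [u] and [v], in units of [sqrt2ln n], are at least 1 apart, so
    [normal_prob_itv_lb] applies between them. The slack in the exponent replaces a sharp tail
    estimate. *)
Lemma near_normal_upper_tail u v : 0 <= u -> u < v -> \forall n \near \oo,
  normal_peak 1 * n%:R `^ (- v ^+ 2) <=
  fine (normal_prob 0 1 `[u * sqrt2ln n, +oo[).
Proof.
move=> u0 uv; near=> n.
have n0 : (0 < n)%N by near: n; exact: nbhs_infty_gt.
have gap : u * sqrt2ln n + 1 <= v * sqrt2ln n by near: n; exact: near_sqrt2ln_gap.
have s0 : 0 <= sqrt2ln n by exact: sqrtr_ge0.
rewrite -expR_sqr_sqrt2ln// -lee_fin fineK ?fin_num_measure//.
apply: (@le_trans _ _ (normal_prob 0 1 `[u * sqrt2ln n, v * sqrt2ln n[)).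
  apply: normal_prob_itv_lb => //.
  by rewrite -mulNr ler_wpM2r//; lra.
rewrite le_measure ?inE//=.
by apply: subset_itvl.
Unshelve. all: by end_near. Qed.

Lemma near_normal_lower_tail u v : 0 <= u -> u < v -> \forall n \near \oo,
  normal_peak 1 * n%:R `^ (- v ^+ 2) <=
  fine (normal_prob 0 1 `]-oo, - u * sqrt2ln n[).
Proof.
move=> u0 uv; near=> n.
have n0 : (0 < n)%N by near: n; exact: nbhs_infty_gt.
have gap : u * sqrt2ln n + 1 <= v * sqrt2ln n by near: n; exact: near_sqrt2ln_gap.
have s0 : 0 <= sqrt2ln n by exact: sqrtr_ge0.
rewrite -expR_sqr_sqrt2ln// -lee_fin fineK ?fin_num_measure//.
apply: (@le_trans _ _ (normal_prob 0 1 `[- v * sqrt2ln n, - u * sqrt2ln n[)).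
  apply: normal_prob_itv_lb; rewrite ?mulNr//; first lra.
  have : 0 <= u * sqrt2ln n by rewrite mulr_ge0.
  by lra.
rewrite le_measure ?inE//=.
by apply: subset_itvr.
Unshelve. all: by end_near. Qed.

(** Serves the case [kb = 0], where the threshold exceeds [mu] and almost every signal is missed by
    it. *)
Lemma near_normal_bulk v eps : 0 < v -> 0 < eps -> \forall n \near \oo,
  1 - eps <= fine (normal_prob 0 1 `]-oo, v * sqrt2ln n[).
Proof.
move=> v0 eps0; have [x0 hx0] := normal_prob_Nyo_cvg1 eps0.
apply: filterS (near_sqrt2ln_ge (x0 / v)) => n h; apply: hx0.
by rewrite mulrC -ler_pdivrMr.
Qed.

End asymptotics.

(** * Choice of the threshold and bookkeeping of exponents *)

(* The threshold is [v * sqrt2ln n], whose square is [2 v^2 log n]: it must be low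
   enough for independent nulls to spoil the FDR ([v^2 < s + ka]), and high
   enough for missed signals to spoil the FNR ([(sqrt r - v)^2 < kb]). *)
Lemma threshold_choice (R : realType) (s r ka kb : R) :
  0 < s -> s < r -> r < 1 -> 0 <= ka -> 0 <= kb ->
  Num.sqrt r < Num.sqrt (s + ka) + Num.sqrt kb ->
  exists v v', [/\ 0 <= v, v < v', v' ^+ 2 < s + ka & v' ^+ 2 < 1] /\
    ((kb = 0 /\ Num.sqrt r < v) \/
     exists b b', [/\ 0 <= b, b < b', b' ^+ 2 < kb, b' ^+ 2 < 1 - s &
                      Num.sqrt r - v <= b]).
Proof.
move=> s0 sr r1 ka0 kb0 lt_r.
set S := Num.sqrt (s + ka) in lt_r; set B := Num.sqrt kb in lt_r.
set rt := Num.sqrt r in lt_r *.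
have rt0 : 0 <= rt by exact: sqrtr_ge0.
have rt1 : rt < 1 by rewrite -sqrtr1 ltr_sqrt.
have S0 : 0 < S by rewrite sqrtr_gt0; lra.
have S2 : S ^+ 2 = s + ka by rewrite sqr_sqrtr//; lra.
have B2 : B ^+ 2 = kb by rewrite sqr_sqrtr.
have B0 : 0 <= B by exact: sqrtr_ge0.
(* The two caps on [v']: below [S] for the FDR, below 1 so that the expected number of independent
   nulls above the threshold grows. *)
pose top := Num.min S 1.
have [topS top1] : top <= S /\ top <= 1 by split; rewrite ge_min lexx ?orbT.
have top0 : 0 < top by rewrite lt_min S0 ltr01.
have v'_ok v' : 0 <= v' -> v' < top -> v' ^+ 2 < s + ka /\ v' ^+ 2 < 1.
  move=> v'0 v'top; split; last by rewrite expr_lt1//; lra.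
  by rewrite -S2 ltr_pXn2r// ?nnegrE ?(ltW S0)//; lra.
have [kbE|kb_gt0] : kb = 0 \/ 0 < kb.
  by move: kb0; rewrite le_eqVlt => /predU1P[<-|]; [left|right].
  have rt_top : rt < top.
    by rewrite lt_min rt1 andbT; move: lt_r; rewrite /B kbE sqrtr0 addr0.
  exists ((rt * 2 + top) / 3), ((rt + top * 2) / 3).
  have [||? ?] := v'_ok ((rt + top * 2) / 3); [lra|lra|].
  by split; [split => //; lra|left; split => //; lra].
have B_gt0 : 0 < B by rewrite sqrtr_gt0.
pose Q := Num.sqrt (1 - s).
have Q2 : Q ^+ 2 = 1 - s by rewrite sqr_sqrtr//; lra.
have Q0 : 0 < Q by rewrite sqrtr_gt0; lra.
(* From [rt < 1] and [1 - sqrt s <= sqrt (1 - s)]. It leaves room for [b'] below [Q], which makes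
   the expected number of missed signals grow. *)
have rtSQ : rt - S < Q.
  have S1 : Num.sqrt s <= S by rewrite ler_wsqrtr//; lra.
  set sq := Num.sqrt s in S1.
  have sq2 : sq ^+ 2 = s by rewrite sqr_sqrtr// ltW.
  have sq0 : 0 <= sq by exact: sqrtr_ge0.
  have sq1 : sq < 1 by rewrite -sqrtr1 ltr_sqrt//; lra.
  have : 1 - sq <= Q by rewrite -ler_sqr ?nnegrE ?(ltW Q0) ?Q2//; nra.
  lra.
pose lim := Num.min B Q.
have [limB limQ] : lim <= B /\ lim <= Q by split; rewrite ge_min lexx ?orbT.
pose X := Num.max 0 (rt - top).
have [X0 Xrt] : 0 <= X /\ rt - top <= X by split; rewrite le_max lexx ?orbT.
have Xlim : X < lim.
  rewrite gt_max !lt_min B_gt0 Q0 /= /top.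
  by case: (leP S 1) => ?; apply/andP; split; lra.
(* Lowering [v] to [top - 2 * d] raises [sqrt r - v] to at most [X + 2 * d], which is taken as [b];
   a quarter of each gap leaves [b'] below [lim] and [v] positive. *)
pose d := Num.min (lim - X) top / 4.
have d0 : 0 < d by rewrite divr_gt0// lt_min subr_gt0 Xlim.
have [dlim dtop] : d * 4 <= lim - X /\ d * 4 <= top.
  by rewrite /d divfK//; split; rewrite ge_min lexx ?orbT.
exists (top - 2 * d), (top - d).
have [||? ?] := v'_ok (top - d); [lra|lra|].
split; first by split => //; lra.
right; exists (X + 2 * d), (X + 3 * d); split; [lra|lra| | |lra].
- by rewrite -B2 ltr_pXn2r// ?nnegrE//; lra.
- by rewrite -Q2 ltr_pXn2r// ?nnegrE ?(ltW Q0)//; lra.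
Qed.

(** Each term becomes a constant times a power of [x]. The four differences in the exponents are the
    ones that [threshold_choice] controls, with [e] in the role of [v' ^ 2] and [f] of [b' ^ 2] or
    0. *)
Lemma tradeoff_le (R : realType) (s ka kb c C C' e f theta x m N p q : R) :
  0 < c -> 0 < C -> 0 < C' -> 0 < theta < 1 -> 1 <= x ->
  x `^ (1 - s) / 2 <= m -> m <= 2 * x `^ (1 - s) -> x / 2 <= N ->
  C * x `^ (- e) <= p -> C' * x `^ (- f) <= q ->
  (1 + m / (theta * (N * p))) * (c * x `^ (- ka)) +
    (theta * q)^-1 * (c * x `^ (- kb)) +
    (((1 - theta) ^+ 2 * (N * p))^-1 + ((1 - theta) ^+ 2 * (m * q))^-1) <=
  c * x `^ (- ka) + 4 * c / (theta * C) * x `^ (- (s + ka - e)) +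
    c / (theta * C') * x `^ (- (kb - f)) +
    (2 / ((1 - theta) ^+ 2 * C) * x `^ (- (1 - e)) +
     2 / ((1 - theta) ^+ 2 * C') * x `^ (- (1 - s - f))).
Proof.
move=> c0 C0 C'0 /andP[th0 th1] x1 m_lb m_ub N_lb p_lb q_lb.
have x0 : 0 < x by lra.
have PD a b : x `^ a * x `^ b = x `^ (a + b) by rewrite powRD// (gt_eqF x0) implybT.
have P0 a : 0 < x `^ a by exact: powR_gt0.
have PV a : (x `^ a)^-1 = x `^ (- a) by rewrite powRN.
have th2 : 0 < (1 - theta) ^+ 2 by rewrite exprn_gt0// subr_gt0.
have Np_lb : C / 2 * x `^ (1 - e) <= N * p.
  rewrite -PD powRr1 ?(ltW x0)// (_ : _ * _ = x / 2 * (C * x `^ (- e))); last ring.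
  by apply: ler_pM => //; rewrite ?divr_ge0 ?mulr_ge0// ltW.
have mq_lb : C' / 2 * x `^ (1 - s - f) <= m * q.
  rewrite -PD (_ : _ * _ = x `^ (1 - s) / 2 * (C' * x `^ (- f))); last ring.
  by apply: ler_pM => //; rewrite ?divr_ge0 ?mulr_ge0// ltW.
have Np_inv : (N * p)^-1 <= 2 / C * x `^ (- (1 - e)).
  rewrite -PV -[2 / C]invf_div -invfM lef_pV2 ?posrE//; last first.
    by rewrite mulr_gt0// divr_gt0.
  by rewrite (lt_le_trans _ Np_lb)// mulr_gt0// divr_gt0.
have mq_inv : (m * q)^-1 <= 2 / C' * x `^ (- (1 - s - f)).
  rewrite -PV -[2 / C']invf_div -invfM lef_pV2 ?posrE//; last first.
    by rewrite mulr_gt0// divr_gt0.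
  by rewrite (lt_le_trans _ mq_lb)// mulr_gt0// divr_gt0.
have q_inv : q^-1 <= C'^-1 * x `^ f.
  rewrite -[x `^ f]invrK PV -invfM lef_pV2 ?posrE//; last by rewrite mulr_gt0.
  by rewrite (lt_le_trans _ q_lb)// mulr_gt0.
have Np0 : 0 <= (N * p)^-1.
  by rewrite invr_ge0 (le_trans _ Np_lb)// ltW// mulr_gt0// divr_gt0.
apply: lerD; first apply: lerD.
- rewrite mulrDl mul1r lerD2l invfM.
  rewrite (_ : 4 * c / _ * _ = 2 * x `^ (1 - s) * (theta^-1 *
     (2 / C * x `^ (- (1 - e)))) * (c * x `^ (- ka))); last first.
    rewrite (_ : - (s + ka - e) = (1 - s) + (- (1 - e) + - ka)); last ring.
    rewrite -!PD; field; lra.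
  rewrite ler_wpM2r ?mulr_ge0 ?(ltW c0) ?(ltW (P0 _))//.
  apply: ler_pM => //.
  + by rewrite (le_trans _ m_lb)// divr_ge0// ltW.
  + by rewrite mulr_ge0// invr_ge0 ltW.
  + by rewrite ler_wpM2l// invr_ge0 ltW.
- rewrite (_ : c / _ * _ = theta^-1 * (C'^-1 * x `^ f) * (c * x `^ (- kb))); last first.
    rewrite (_ : - (kb - f) = f + - kb); last ring.
    rewrite -PD; field; lra.
  rewrite ler_wpM2r ?mulr_ge0 ?(ltW c0) ?(ltW (P0 _))// invfM.
  by rewrite ler_wpM2l// invr_ge0 ltW.
- rewrite !(invfM ((1 - theta) ^+ 2)) !mulrA.
  by apply: lerD; rewrite [2 * _]mulrC -!mulrA ler_wpM2l ?invr_ge0 ?(ltW th2)// mulrA.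
Qed.

(** * Contradiction for large n *)

Section impossibility.
Local Open Scope classical_set_scope.
Local Open Scope ring_scope.

(** A negative exponent would send the risk level to infinity, whereas [controlled] keeps it at most
    1. *)
Lemma exponent_ge0 (R : realType) (c k : R) (n0 : nat) : 0 < c ->
  (forall n, (n0 <= n)%N -> c * n%:R `^ (- k) <= 1) -> 0 <= k.
Proof.
move=> c0 h; rewrite leNgt; apply/negP => k0.
have Nk0 : 0 < - k by rewrite oppr_gt0.
have [n /= [[n1 nn0] small]] := filter_ex (filterI (filterI (nbhs_infty_gt 0%N)
  (nbhs_infty_ge n0)) (near_natr_powRN_lt c^-1 Nk0 ltr01)).
have Pn : 0 < n%:R `^ k :> R by rewrite powR_gt0// ltr0n.
move: (h _ nn0) small; rewrite opprK powRN ler_pdivrMr// mul1r => le_c.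
by rewrite mulrC ltr_pdivrMr// mul1r ltNge le_c.
Qed.

(** Up to rounding [m] is [n ^ (1 - s)] and [A] is at most [n ^ t], so [t < s] makes [m * A]
    negligible against [n]. *)
Lemma near_group_sizes (R : realType) (s t : R) (m A : nat -> nat) (n0 : nat) :
  0 <= t -> t < s -> s < 1 ->
  (forall n, (n0 <= n)%N -> `|(m n)%:R - n%:R `^ (1 - s)| < 1 /\
    `|(A n)%:R - (n%:R - (m n)%:R) / n%:R `^ (1 - t)| < 1 :> R) ->
  \forall n \near \oo, [/\ n%:R `^ (1 - s) / 2 <= (m n)%:R,
    (m n)%:R <= 2 * n%:R `^ (1 - s) &
    n%:R / 2 <= n%:R - (m n)%:R - (m n)%:R * (A n)%:R :> R].
Proof.
move=> t0 ts s1 sizes.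
have e1 : 0 < 1 - s by rewrite subr_gt0.
have e2 : 0 < s by exact: le_lt_trans ts.
have e3 : 0 < s - t by rewrite subr_gt0.
near=> n.
have nn0 : (n0 <= n)%N by near: n; exact: nbhs_infty_ge.
have [m_size A_size] := sizes _ nn0.
have x1 : 1 <= n%:R :> R by near: n; exact: nbhs_infty_ger.
(* The 2 makes the rounding error at most half of [n ^ (1 - s)]; the 8 and the 16 bound [m] and
   [m * A] by [n / 4] each. *)
have m_large : 2 * n%:R `^ (- (1 - s)) < 1 :> R.
  by near: n; exact: near_natr_powRN_lt.
have m_small : 8 * n%:R `^ (- s) < 1 :> R.
  by near: n; exact: near_natr_powRN_lt.
have mA_small : 16 * n%:R `^ (- (s - t)) < 1 :> R.
  by near: n; exact: near_natr_powRN_lt.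
set x : R := n%:R in x1 m_size A_size m_large m_small mA_small *.
have x0 : 0 < x by exact: lt_le_trans x1.
have P0 a : 0 < x `^ a by exact: powR_gt0.
have PD a b : x `^ a * x `^ b = x `^ (a + b).
  by rewrite powRD// (gt_eqF x0) implybT.
have xE : x `^ (1 - s) = x * x `^ (- s) by rewrite -PD powRr1// ltW.
have Plarge : 2 <= x `^ (1 - s).
  by move: m_large; rewrite powRN ltr_pdivrMr// mul1r => /ltW.
move: m_size; rewrite ltr_norml => /andP[m_lb m_ub].
have m_le : (m n)%:R <= 2 * x `^ (1 - s) by clear -m_ub Plarge; lra.
have A_le : (A n)%:R <= 2 * x `^ t.
  have Pt : 1 <= x `^ t by rewrite -(powRr0 x) ler_powR.
  move: A_size; rewrite ltr_norml => /andP[_ A_ub].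
  have : (x - (m n)%:R) / x `^ (1 - t) <= x `^ t.
    rewrite ler_pdivrMr// PD (_ : t + (1 - t) = 1); last by rewrite addrC subrK.
    by rewrite powRr1 ?(ltW x0)// lerBlDr lerDl.
  by clear -Pt A_ub; lra.
have mA_le : (m n)%:R * (A n)%:R <= 4 * (x * x `^ (- (s - t))).
  rewrite (_ : 4 * _ = 2 * x `^ (1 - s) * (2 * x `^ t)); first exact: ler_pM.
  by rewrite xE (_ : - (s - t) = - s + t) -?PD; ring.
split => //; first by clear -Plarge m_lb; lra.
rewrite xE in m_le.
have h1 : 16 * (x * x `^ (- (s - t))) <= x by rewrite mulrCA ger_pMr// ltW.
have h2 : 8 * (x * x `^ (- s)) <= x by rewrite mulrCA ger_pMr// ltW.
by clear -h1 h2 m_le mA_le; lra.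
Unshelve. all: by end_near. Qed.

(** Treats both cases of [threshold_choice] at once, [C'] and [f] describing the chance that a
    signal falls below the threshold. Only the terms with exponents [ka] and [kb - f] may fail to
    decay; the side conditions keep each below 1 and exclude both at once. *)
Lemma no_controlled_sequence (R : realType) (s r t ka kb c : R)
    (m A : nat -> nat) (n0 : nat) (v v' C' f theta : R) :
  0 <= t -> t < s -> s < 1 -> 0 < c -> 0 <= ka -> 0 <= r ->
  0 <= v -> v < v' -> v' ^+ 2 < s + ka -> v' ^+ 2 < 1 ->
  0 < C' -> 0 < theta < 1 -> f <= kb -> f < 1 - s ->
  (\forall n \near \oo, C' * n%:R `^ (- f) <=
     fine (normal_prob 0 1 `]-oo, (v - Num.sqrt r) * sqrt2ln R n[)) ->
  (ka = 0 -> c < 1) ->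
  (f = kb -> 0 < ka /\ c / (theta * C') < 1) ->
  (forall n, (n0 <= n)%N -> `|(m n)%:R - n%:R `^ (1 - s)| < 1 /\
    `|(A n)%:R - (n%:R - (m n)%:R) / n%:R `^ (1 - t)| < 1 :> R) ->
  ~ (forall n, (n0 <= n)%N ->
    exists (M : grouped_model R n (m n) (A n)) (T : topK_procedure R n),
      controlled M (Num.sqrt (2 * r * ln n%:R)) T
        (c * n%:R `^ (- ka)) (c * n%:R `^ (- kb))).
Proof.
move=> t0 ts s1 c0 ka0 r0 v0 vv' v's v'1 C'0 th fkb fs q_lb c1 kc sizes ctrl.
pose C : R := normal_peak 1.
have C0 : 0 < C by rewrite normal_peak_gt0.
have /andP[th0 th1] := th.
(* A budget of 1 for the five terms of [tradeoff_le]: [u1] and [u2] for the two that may be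
   constant, [u3] for each of the other three. *)
have [u1 [u2 [u3 [[u10 u20 u30 usum] cu1 cu2]]]] : exists u1 u2 u3 : R,
    [/\ [/\ 0 < u1, 0 < u2, 0 < u3 & u1 + u2 + u3 * 3 <= 1],
        (ka = 0 -> c < u1) & (kb - f = 0 -> c / (theta * C') < u2)].
  have [fE|fN] := eqVneq f kb.
    have [ka_gt0 k1] := kc fE.
    set k := c / _ in k1 *.
    have k0 : 0 < k by rewrite divr_gt0// mulr_gt0.
    exists ((1 - k) / 8), ((1 + k) / 2), ((1 - k) / 8).
    by clear -k0 k1 ka_gt0; split; [split; lra|lra|lra].
  have fN' : kb - f != 0 by rewrite subr_eq0 eq_sym.
  have [kaE|kaN] := eqVneq ka 0.
    have c1' := c1 kaE.
    exists ((1 + c) / 2), ((1 - c) / 8), ((1 - c) / 8).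
    clear -c0 c1' fN'; split; [split; lra|lra|].
    by move/eqP; rewrite (negbTE fN').
  exists 8^-1, 8^-1, 8^-1; clear -kaN fN'; split; first by split; lra.
    by move/eqP; rewrite (negbTE kaN).
  by move/eqP; rewrite (negbTE fN').
suff : \forall n \near \oo, (1 : R) < 1 by move=> /filter_ex[n]; rewrite ltxx.
near=> n.
have [m_lb m_ub N_lb] : [/\ n%:R `^ (1 - s) / 2 <= (m n)%:R,
    (m n)%:R <= 2 * n%:R `^ (1 - s) &
    n%:R / 2 <= n%:R - (m n)%:R - (m n)%:R * (A n)%:R :> R].
  by near: n; exact: (near_group_sizes t0 ts s1 sizes).
have nn0 : (n0 <= n)%N by near: n; exact: nbhs_infty_ge.
have [M [T MT]] := ctrl _ nn0.
have x1 : 1 <= n%:R :> R by near: n; exact: nbhs_infty_ger.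
have p_lb : C * n%:R `^ (- v' ^+ 2) <=
    fine (normal_prob 0 1 `[v * sqrt2ln R n, +oo[).
  by near: n; exact: near_normal_upper_tail.
have muE : Num.sqrt (2 * r * ln n%:R) = Num.sqrt r * sqrt2ln R n.
  by rewrite /sqrt2ln -sqrtrM// mulrCA mulrA.
have q_lb' : C' * n%:R `^ (- f) <= fine (normal_prob 0 1
    `]-oo, v * sqrt2ln R n - Num.sqrt (2 * r * ln n%:R)[).
  by rewrite muE -mulrBl; near: n; exact: q_lb.
have x0 : 0 < n%:R :> R by exact: lt_le_trans x1.
have P0 a : 0 < n%:R `^ a :> R by exact: powR_gt0.
have m0 : (0 < m n)%N.
  by rewrite -(ltr0n R) (lt_le_trans _ m_lb)// divr_gt0.
have N_lb' : n%:R / 2 <= #|independent_nulls (design M)|%:R :> R.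
  rewrite (le_trans N_lb)// !lerBlDr -natrM -!natrD ler_nat.
  by rewrite addnAC card_independent_nulls.
have N0 : (0 < #|independent_nulls (design M)|)%N.
  by rewrite -(ltr0n R) (lt_le_trans _ N_lb')// divr_gt0.
set p := fine _ in p_lb; set q := fine _ in q_lb'.
have p0 : 0 < p by rewrite (lt_le_trans _ p_lb)// mulr_gt0.
have q0 : 0 < q by rewrite (lt_le_trans _ q_lb')// mulr_gt0.
have := controlled_tradeoff (p := p) (q := q) (tau := v * sqrt2ln R n) MT m0 N0.
rewrite !fineK ?fin_num_measure// => /(_ theta erefl p0 erefl q0 th).
move=> /le_lt_trans; apply; rewrite (le_lt_trans (tradeoff_le (s := s) (e := v' ^+ 2)
  ka kb c0 C0 C'0 th x1 m_lb m_ub N_lb' p_lb q_lb'))//.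
apply: (lt_le_trans _ usum).
rewrite (_ : u1 + u2 + _ = u1 + u3 + u2 + (u3 + u3)); last ring.
apply: ltrD; first apply: ltrD; first apply: ltrD; last apply: ltrD; near: n.
- exact: near_natr_powRN_lt_ge0.
- by apply: near_natr_powRN_lt => //; rewrite subr_gt0.
- by apply: near_natr_powRN_lt_ge0 => //; rewrite subr_ge0.
- by apply: near_natr_powRN_lt => //; rewrite subr_gt0.
- by apply: near_natr_powRN_lt => //; rewrite subr_gt0.
Unshelve. all: by end_near. Qed.

End impossibility.

(** The integers [m n] and [A n] are within 1 of the real formulas, so any rounding is allowed. The
    condition at [c = 1] excludes levels equal to 1, which rejecting everything or nothing would
    meet with the other risk zero. *)
Theorem corollary4 (R : realType) (s r t kappa_a kappa_b c : R)
    (m A : nat -> nat) (n0 : nat) :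
  0 <= t -> t < s -> s < r -> r < 1 -> 0 < c ->
  (forall n : nat, (n0 <= n)%N ->
    `|(m n)%:R - n%:R `^ (1 - s)| < 1 /\
    `|(A n)%:R - (n%:R - (m n)%:R) / n%:R `^ (1 - t)| < 1) ->
  (c = 1 -> 0 < kappa_a /\ 0 < kappa_b) ->
  (forall n : nat, (n0 <= n)%N ->
    exists (M : grouped_model R n (m n) (A n)) (T : topK_procedure R n),
      controlled M (Num.sqrt (2 * r * ln n%:R)) T
        (c * n%:R `^ (- kappa_a)) (c * n%:R `^ (- kappa_b))) ->
  Num.sqrt (s + kappa_a) + Num.sqrt kappa_b <= Num.sqrt r.
Proof.
move=> t0 ts sr r1 c0 sizes c1 ctrl.
have s0 : 0 < s by lra.
have s1 : s < 1 by lra.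
have r0 : 0 < r by lra.
have ka0 : 0 <= kappa_a.
  apply: (exponent_ge0 (n0 := n0) c0) => n /ctrl[M [T []]].
  by move=> /andP[].
have kb0 : 0 <= kappa_b.
  apply: (exponent_ge0 (n0 := n0) c0) => n /ctrl[M [T []]].
  by move=> _ /andP[].
(* With a zero exponent [c] is itself a risk level, hence at most 1. *)
have c_lt1 : kappa_a = 0 \/ kappa_b = 0 -> c < 1.
  move=> k0; rewrite lt_neqAle; apply/andP; split.
    by apply/eqP => /c1[]; case: k0 => ->; rewrite ltxx.
  have [M [T [/andP[_ ca] /andP[_ cb] _ _]]] := ctrl _ (leqnn n0).
  by case: k0 ca cb => ->; rewrite oppr0 powRr0 mulr1.
rewrite leNgt; apply/negP => lt_r.
have [v [v' [[v0 vv' v's v'1] q_case]]] := threshold_choice s0 sr r1 ka0 kb0 lt_r.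
have ca1 : kappa_a = 0 -> c < 1 by move=> h; apply: c_lt1; left.
case: q_case => [[kbE v_r]|[b [b' [b0 bb' b'kb b's v_r]]]].
- have c_1 : c < 1 by apply: c_lt1; right.
  (* Here [C' = theta], so [c < theta ^ 2] is required; the difference is [((1 - c) / 2) ^ 2]. *)
  pose theta := (1 + c) / 2.
  have th : 0 < theta < 1 by apply/andP; rewrite /theta; split; lra.
  have /andP[th0 th1] := th.
  apply: (no_controlled_sequence (C' := theta) (f := 0) (theta := theta)
    t0 ts s1 c0 ka0 (ltW r0) v0 vv' v's v'1 _ th kb0 _ _ ca1 _ sizes ctrl) => //.
  + by lra.
  + have vr0 : 0 < v - Num.sqrt r by rewrite subr_gt0.
    have e0 : 0 < 1 - theta by lra.
    apply: filterS (near_normal_bulk vr0 e0) => n.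
    by rewrite oppr0 powRr0 mulr1 subKr.
  + move=> _; split.
      (* Both exponents zero would give [sqrt r < sqrt s], against [s < r]. *)
      rewrite lt_neqAle ka0 andbT; apply/eqP => kaE.
      have : Num.sqrt s < Num.sqrt r by rewrite ltr_sqrt.
      by move: lt_r; rewrite -kaE kbE sqrtr0 !addr0; lra.
    rewrite ltr_pdivrMr; last exact: mulr_gt0.
    rewrite mul1r.
    have : 0 < (1 - c) ^+ 2 by rewrite exprn_gt0// subr_gt0.
    by rewrite /theta; lra.
(* Since [f < kappa_b], [theta] only enters decaying terms and any value in []0, 1[] would do. *)
- have th : 0 < (2^-1 : R) < 1 by apply/andP; split; lra.
  apply: (no_controlled_sequence (C' := normal_peak 1) (f := b' ^+ 2) (theta := 2^-1)
    t0 ts s1 c0 ka0 (ltW r0) v0 vv' v's v'1 _ th (ltW b'kb) b's _ ca1 _ sizes ctrl).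
  + exact: normal_peak_gt0.
  + apply: filterS (near_normal_lower_tail b0 bb') => n /le_trans; apply.
    rewrite fine_le ?fin_num_measure// le_measure ?inE//=.
    apply: subset_itvl; rewrite bnd_simp ler_wpM2r//; first exact: sqrtr_ge0.
    lra.
  + by move=> fE; move: b'kb; rewrite fE ltxx.
Qed.
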